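(* Let $(N,\nu)$ be an entropic value-at-risk (EVaR) portfolio game, i.e. for each coalition $S\subseteq N$, $$\nu(S)=\max\Big\{\langle\mu,x\rangle:\ \sum_{j=1}^mx_j=c(S),\ y_t=\sum_{j=1}^mr_{jt}x_j\ (t=1,\dots,T),\ \mathrm{EVaR}_\beta(y)\le R(S),\ x\ge0\Big\}.$$ If the risk threshold mapping $R$ is additive, i.e. $R(S)=\sum_{i\in S}R(\{i\})$ for every coalition $S\subseteq N$, or satisfies $\frac{R(T)}{|T|}\ge\frac{R(S)}{|S|}$ for all coalitions $S,T\subseteq N$ with $|S|\le|T|$, then $(N,\nu)$ is superadditive. Moreover, if in addition the exponential cone program $$\nu(N)=\max\ \langle\mu,x\rangle\quad\text{s.t.}\quad\sum_{j=1}^mx_j=c(N),\quad y_t=\sum_{j=1}^mr_{jt}x_j\ \ \forall t,\quad w+z\ln\Big(\frac1{1-\beta}\Big)\le R(N),$$ $$z\ge\sum_{t=1}^Tp_tu_t,\quad x\ge0,\quad (y_t-w,z,u_t)\in\mathcal{K}_{\exp}\ \ \forall t=1,\dots,T$$ for the grand coalition $N$ satisfies the Slater condition, then the core of $(N,\nu)$ is nonempty.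
   Context: $N$ is a finite set of agents; agent $i$ owns capital $c_i$ and $c(S)=\sum_{i\in S}c_i$; $R(S)\ge0$ is the admissible risk threshold of coalition $S$. There are $m$ assets and $T$ scenarios with probabilities $p_t\ge0$, $\sum_{t=1}^Tp_t=1$; $r_{jt}$ is the return of asset $j$ in scenario $t$ and $\mu_j=\sum_{t=1}^Tp_tr_{jt}$. For a confidence level $0<\beta<1$, $$\mathrm{EVaR}_\beta(y)=\min_{z\ge0}z\ln\Big(\frac1{1-\beta}\sum_{t=1}^Tp_t\exp\Big(\frac{y_t}z\Big)\Big),$$ the expression at $z=0$ being understood as its limit as $z\to0^+$. The exponential cone is $\mathcal{K}_{\exp}=\mathrm{cl}\{(a,b,c)\in\mathbb{R}^3:b>0,\ c\ge b\exp(a/b)\}$. ''max'' denotes the optimal value; since $(N,\nu)$ is a TU game, $\nu$ is real-valued. Coalitions in the ratio condition on $R$ are nonempty. The Slater condition for a conic program (linear inequalities being written with slack variables in the nonnegative orthant) means that there is a feasible point in the interior of the cone; here: a feasible $(x,y,w,z,u)$ with $x>0$, with the two inequality constraints strict and with all $(y_t-w,z,u_t)$ in the interior of $\mathcal{K}_{\exp}$. $(N,\nu)$ is superadditive if $\nu(S\cup T)\ge\nu(S)+\nu(T)$ for all $S,T\subseteq N$ with $S\cap T=\emptyset$. The core is the set of $z\in\mathbb{R}^N$ with $\sum_{i\in N}z_i=\nu(N)$ and $\sum_{i\in S}z_i\ge\nu(S)$ for all coalitions $\emptyset\ne S\subset N$. *)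

(* Defs.v *)
From HB Require Import structures.
From mathcomp Require Import all_boot all_order all_algebra.
From mathcomp Require Import all_classical all_reals all_analysis.

Set Implicit Arguments.
Unset Strict Implicit.
Unset Printing Implicit Defensive.

Import Order.TTheory GRing.Theory Num.Theory.
Import numFieldNormedType.Exports.

Local Open Scope classical_set_scope.
Local Open Scope ring_scope.

Section EVaR.
Context {R : realType} {T : nat}.
Implicit Types (beta z : R) (p y : 'I_T -> R).

Definition evar_expr beta p y z : R :=
  z * ln ((1 - beta)^-1 * \sum_(t < T) p t * expR (y t / z)).

(* At z = 0 the expression is its right limit (and not the value given by the
   library's convention x / 0 = 0). *)
Definition evar_obj beta p y z : R :=
  if z == 0 then lim (evar_expr beta p y s @[s --> 0^'+])
  else evar_expr beta p y z.

(* When p is a probability vector and 0 < beta < 1, the objective is bounded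
   below by the mean of y, continuous on [0, +oo[ and tends to +oo at +oo, so
   this infimum is a minimum. *)
Definition evar beta p y : R :=
  inf [set evar_obj beta p y z | z in [set z | 0 <= z]].

End EVaR.

Section ExpCone.
Context {R : realType}.

(* A triple (a, b, c) is encoded as ((a, b), c) in R * R * R, with the product
   topology. *)
Definition exp_cone : set (R * R * R) :=
  closure [set v | 0 < v.1.2 /\ v.1.2 * expR (v.1.1 / v.1.2) <= v.2].

End ExpCone.

Section TUGame.
Context {R : realType} {N : finType}.
Implicit Types nu risk : {set N} -> R.

Definition superadditive nu : Prop :=
  forall S S' : {set N}, S :&: S' = finset.set0 ->
    nu S + nu S' <= nu (S :|: S').

Definition core nu : set (N -> R) :=
  [set a | \sum_i a i = nu [set: N]%SET /\
    forall S : {set N}, S != finset.set0 -> S \proper [set: N]%SET ->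
      nu S <= \sum_(i in S) a i].

Definition risk_additive risk : Prop :=
  forall S : {set N}, risk S = \sum_(i in S) risk [set i]%SET.

Definition risk_ratio_monotone risk : Prop :=
  forall S S' : {set N}, S != finset.set0 -> S' != finset.set0 ->
    (#|S| <= #|S'|)%N -> risk S / #|S|%:R <= risk S' / #|S'|%:R.

End TUGame.

Section Portfolio.
Context {R : realType} {N : finType} {m T : nat}.
Variables (c : N -> R) (risk : {set N} -> R).
Variables (p : 'I_T -> R) (r : 'I_m -> 'I_T -> R) (beta : R).
Implicit Types (x : 'I_m -> R) (y u : 'I_T -> R) (w z : R) (S : {set N}).

Definition capital S : R := \sum_(i in S) c i.

Definition mean_return (j : 'I_m) : R := \sum_(t < T) p t * r j t.

Definition expected_return x : R := \sum_(j < m) mean_return j * x j.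

Definition portfolio_return x (t : 'I_T) : R := \sum_(j < m) r j t * x j.

Definition evar_feasible S : set ('I_m -> R) :=
  [set x | [/\ \sum_(j < m) x j = capital S,
               evar beta p (portfolio_return x) <= risk S &
               forall j, 0 <= x j]].

(* The optimal value is taken in the extended reals, where it is -oo for an
   infeasible program and +oo for an unbounded one; equating it with the real
   number nu S says in particular that the program of S is feasible and
   bounded. *)
Definition evar_game (nu : {set N} -> R) : Prop :=
  forall S,
    (nu S)%:E = ereal_sup [set (expected_return x)%:E | x in evar_feasible S].

Definition cone_feasible S x y w z u : Prop :=
  [/\ \sum_(j < m) x j = capital S,
      forall t, y t = portfolio_return x t,
      w + z * ln ((1 - beta)^-1) <= risk S /\ \sum_(t < T) p t * u t <= z,
      forall j, 0 <= x j &
      forall t, exp_cone (y t - w, z, u t)].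

Definition cone_slater S : Prop :=
  exists x y w z u, cone_feasible S x y w z u /\
    [/\ forall j, 0 < x j,
        w + z * ln ((1 - beta)^-1) < risk S,
        \sum_(t < T) p t * u t < z &
        forall t, interior exp_cone (y t - w, z, u t)].

End Portfolio.

(* Main.v *)
Require Import Defs.
From HB Require Import structures.
From mathcomp Require Import all_boot all_order all_algebra.
From mathcomp Require Import all_classical all_reals all_analysis.
From mathcomp Require Import ring lra.

Set Implicit Arguments.
Unset Strict Implicit.
Unset Printing Implicit Defensive.

Import Order.TTheory GRing.Theory Num.Theory.
Import numFieldNormedType.Exports.

Local Open Scope classical_set_scope.
Local Open Scope ring_scope.

(** Superadditivity. EVaR is sublinear: it is the infimum over [z > 0] of
    [evar_expr], and [evar_expr beta p y z <= w] says that
    [(1 - beta)^-1 * \sum_t p t * expR ((y t - w) / z) <= 1], a condition that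
    two triples [(y, w, z)] transmit to their sum because [expR] is convex
    ([evar_expr_le], [evarD_le]). The sum of feasible portfolios of two disjoint
    coalitions is therefore feasible for their union as soon as the thresholds
    are superadditive, which either condition on [risk] gives for nonempty
    coalitions ([risk_superadditive]); the empty coalition has value 0.

    Core. A Slater point gives a portfolio of the grand coalition with EVaR
    strictly below the threshold ([slater_evar_lt]), hence a Lagrange multiplier
    [lam >= 0] for the risk constraint ([lagrange_multiplier]). By positive
    homogeneity the programs of all coalitions with positive capital are
    rescalings of one program with varying threshold, so that the same
    multiplier bounds every value by a linear function of capital and threshold,
    [nu S <= capital c S * kappa + lam * risk S], with equality for the grand
    coalition ([nu_supergradient]). Seen as a game, [risk] has a core allocation
    [q] ([risk_core]); since capital is additive and [lam >= 0], the vector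
    [c i * kappa + lam * q i] lies in the core of [nu]. When the total capital
    is 0, all values are 0 and so is the core allocation. *)

(** * Sublinearity of EVaR *)

Section EVaRTheory.
Context (R : realType) (T : nat) (p : 'I_T -> R) (beta : R).
Hypothesis p_ge0 : forall t, 0 <= p t.
Hypothesis p_sum1 : \sum_(t < T) p t = 1.
Hypothesis beta01 : 0 < beta < 1.
Implicit Types (y : 'I_T -> R) (w z k m : R).

Let conf_gt0 : 0 < (1 - beta)^-1.
Proof. by rewrite invr_gt0 subr_gt0; case/andP: beta01. Qed.

Let conf_ge1 : 1 <= (1 - beta)^-1.
Proof. by case/andP: beta01 => b0 b1; rewrite invf_ge1; lra. Qed.

Lemma mean_expR_ge y m : (forall t, m <= y t) ->
  expR m <= \sum_(t < T) p t * expR (y t).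
Proof.
move=> my; rewrite -[leLHS]mul1r -p_sum1 mulr_suml.
by apply: ler_sum => t _; rewrite ler_wpM2l// ler_expR.
Qed.

Let opp_sum_norm_le y t : - \sum_(t < T) `|y t| <= y t.
Proof. by apply: lerNnormlW; rewrite (bigD1 t)//= lerDl sumr_ge0. Qed.

Lemma mean_expR_gt0 y : 0 < \sum_(t < T) p t * expR (y t).
Proof.
apply: (@lt_le_trans _ _ (expR (- \sum_(t < T) `|y t|))); first exact: expR_gt0.
by apply: mean_expR_ge; exact: opp_sum_norm_le.
Qed.

(** The logarithm is eliminated by pushing [w] under the exponential; the
    condition on the right is jointly convex in [(y, w, z)]. *)
Lemma evar_expr_le y w z : 0 < z ->
  (evar_expr beta p y z <= w) =
  ((1 - beta)^-1 * \sum_(t < T) p t * expR ((y t - w) / z) <= 1).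
Proof.
move=> z0; rewrite /evar_expr -ler_pdivlMl//.
rewrite -{1}[_ * w]expRK ler_ln ?posrE ?expR_gt0 ?mulr_gt0 ?mean_expR_gt0//.
under [in RHS]eq_bigr => t _ do rewrite mulrBl expRD mulrA.
rewrite -mulr_suml mulrA expRN ler_pdivrMr ?expR_gt0// mul1r.
by rewrite [z^-1 * w]mulrC.
Qed.

Lemma evar_expr_ge y m z : 0 < z -> (forall t, m <= y t) ->
  m <= evar_expr beta p y z.
Proof.
move=> z0 my; rewrite /evar_expr -ler_pdivrMl//.
rewrite -{1}[_ * m]expRK ler_ln ?posrE ?expR_gt0 ?mulr_gt0 ?mean_expR_gt0//.
rewrite -[leLHS]mul1r ler_pM ?expR_ge0//.
apply: mean_expR_ge => t.
by rewrite [_ * m]mulrC ler_pM2r ?invr_gt0.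
Qed.

(** The limit [M] is the largest value of [y] on the support of [p]: with
    [p t0 > 0] and [y t0] maximal, the expression lies between
    [y t0 + z ln (p t0 / (1 - beta))] and [y t0 + z ln (1 / (1 - beta))]. *)
Lemma cvg_evar_expr0 y : exists M : R,
  evar_expr beta p y s @[s --> 0^'+] --> M.
Proof.
have [t1 pt1] : exists t, 0 < p t.
  apply: contrapT => np; have : \sum_(t < T) p t = 0.
    apply: big1 => t _; apply/eqP; rewrite eq_le p_ge0 andbT leNgt.
    by apply/negP => pt; apply: np; exists t.
  by rewrite p_sum1 => /eqP; rewrite oner_eq0.
have [t0 pt0 yt0] := @arg_maxP _ _ _ t1 (fun t => 0 < p t) y pt1.
exists (y t0).
have cvg_affine (C : R) : y t0 + s * C @[s --> 0^'+] --> y t0.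
  rewrite -[X in _ --> X]addr0 -[X in _ + X](mul0r C).
  apply: cvg_at_right_filter.
  apply: cvgD; first exact: cvg_cst.
  by apply: cvgM; [exact: cvg_id | exact: cvg_cst].
apply: (squeeze_cvgr _ (cvg_affine (ln ((1 - beta)^-1 * p t0)))
                       (cvg_affine (ln ((1 - beta)^-1)))).
near=> s.
have s0 : 0 < s by near: s; exact: nbhs_right_gt.
have sE : y t0 = s * ln (expR (y t0 / s)).
  by rewrite expRK mulrC divfK// gt_eqF.
apply/andP; split.
  rewrite {1}sE -mulrDr /evar_expr ler_pM2l//.
  rewrite -lnM ?posrE ?expR_gt0 ?mulr_gt0//.
  rewrite ler_ln ?posrE ?mulr_gt0 ?mean_expR_gt0 ?expR_gt0//.
  rewrite mulrC -mulrA ler_pM2l// (bigD1 t0)//= lerDl sumr_ge0// => t _.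
  by rewrite mulr_ge0 ?expR_ge0.
rewrite evar_expr_le//.
have cE : 1 - beta = expR (- ln ((1 - beta)^-1)).
  by rewrite expRN lnK ?posrE// invrK.
rewrite ler_pdivrMl; last by rewrite -invr_gt0.
rewrite mulr1 [leRHS]cE.
rewrite -[leRHS]mul1r -[X in _ <= X * _]p_sum1 mulr_suml.
apply: ler_sum => t _; have := p_ge0 t; rewrite le_eqVlt => /predU1P[<-|pt].
  by rewrite !mul0r.
rewrite ler_pM2l// ler_expR ler_pdivrMr// mulrC.
have yt : y t <= y t0 := yt0 _ pt.
lra.
Unshelve. all: by end_near. Qed.

Let evar_has_inf y :
  has_inf [set evar_obj beta p y z | z in [set z | 0 <= z]].
Proof.
split; first by exists (evar_obj beta p y 0), 0 => /=.
exists (- \sum_(t < T) `|y t|) => _ [z /= z0 <-].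
have lb s : 0 < s -> - \sum_(t < T) `|y t| <= evar_expr beta p y s.
  by move=> s0; apply: evar_expr_ge => //; exact: opp_sum_norm_le.
rewrite /evar_obj; case: eqVneq => [_|zN0]; last by apply: lb; rewrite lt_def zN0.
have [M cM] := cvg_evar_expr0 y.
apply: limr_ge; first by apply/cvg_ex; exists M.
by near=> s; apply: lb; near: s; exact: nbhs_right_gt.
Unshelve. all: by end_near. Qed.

(** The value at [z = 0] can be ignored, being a limit of values at [z > 0]. *)
Lemma evar_ltP y w :
  evar beta p y < w <-> exists2 z, 0 < z & evar_expr beta p y z < w.
Proof.
split=> [yw|[z z0 zw]]; last first.
  apply: le_lt_trans zw; apply: ge_inf; first by case: (evar_has_inf y).
  by exists z => /=; [exact: ltW | rewrite /evar_obj gt_eqF].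
have [_ [z /= z0 <-]] := @inf_adherent _ _ (w - evar beta p y)
  ltac:(by rewrite subr_gt0) (evar_has_inf y).
rewrite -/(evar beta p y) addrC subrK /evar_obj.
case: eqVneq => [_|zN0]; last by exists z; rewrite // lt_def zN0.
have [M cM] := cvg_evar_expr0 y.
rewrite (cvg_lim _ cM)// => Mw.
have : \forall s \near 0^'+, 0 < s /\ evar_expr beta p y s < w.
  near=> s; split; first by near: s; exact: nbhs_right_gt.
  by near: s; apply: (cvgr_lt _ cM).
by move=> /filter_ex[s [s0 sw]]; exists s.
Unshelve. all: by end_near. Qed.

Lemma evarZ_le y k : 0 < k ->
  evar beta p (fun t => k * y t) <= k * evar beta p y.
Proof.
move=> k0; apply/ler_addgt0Pr => e e0; apply: ltW.
have /evar_ltP[z z0 zw] : evar beta p y < evar beta p y + e / k.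
  by rewrite ltrDl divr_gt0.
apply/evar_ltP; exists (k * z); first exact: mulr_gt0.
have -> : k * evar beta p y + e = k * (evar beta p y + e / k).
  by field; rewrite gt_eqF.
rewrite /evar_expr -mulrA ltr_pM2l//; move: zw; rewrite /evar_expr.
by under [in X in _ -> X]eq_bigr => t _ do rewrite -mulf_div divff ?gt_eqF// mul1r.
Qed.

Let expR_convex_le (a u v : R) (a0 : 0 <= a) (a1 : a <= 1) :
  expR (a * u + (1 - a) * v) <= a * expR u + (1 - a) * expR v.
Proof. exact: (convex_expR (Itv01 a0 a1) u v). Qed.

(** Subadditivity: [z] and [z'] are added, and the exponents are averaged with
    the weights [z / (z + z')] and [z' / (z + z')]. *)
Lemma evarD_le y y' :
  evar beta p (fun t => y t + y' t) <= evar beta p y + evar beta p y'.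
Proof.
apply/ler_addgt0Pr => e e0; apply: ltW.
have e4 : 0 < e / 4 by rewrite divr_gt0.
have /evar_ltP[z z0 /ltW] : evar beta p y < evar beta p y + e / 4.
  by rewrite ltrDl.
have /evar_ltP[z' z'0 /ltW] : evar beta p y' < evar beta p y' + e / 4.
  by rewrite ltrDl.
set w' := _ + _ => w'P; set w := _ + _ => wP.
apply/evar_ltP; exists (z + z'); first exact: addr_gt0.
apply: (@le_lt_trans _ _ (w + w')); last by rewrite /w /w'; lra.
move: wP w'P; rewrite !evar_expr_le ?addr_gt0// => wP w'P.
set a := z / (z + z').
have zz0 : 0 < z + z' by exact: addr_gt0.
have a01 : 0 <= a <= 1.
  by rewrite /a divr_ge0 ?(ltW z0) ?(ltW zz0)//= ler_pdivrMr// mul1r lerDl ltW.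
have [a0 a1] := andP a01.
apply: (@le_trans _ _ (a * 1 + (1 - a) * 1)); last by rewrite !mulr1 addrC subrK.
apply: le_trans; last first.
  by apply: lerD; apply: ler_wpM2l; [ | exact: wP | rewrite subr_ge0 | exact: w'P].
rewrite [a * _]mulrCA [(1 - a) * _]mulrCA -mulrDr ler_pM2l//.
rewrite !mulr_sumr -big_split/=; apply: ler_sum => t _.
rewrite [a * _]mulrCA [(1 - a) * _]mulrCA -mulrDr ler_wpM2l//.
apply: le_trans (expR_convex_le _ _ a0 a1); rewrite ler_expR le_eqVlt.
by apply/orP; left; apply/eqP; rewrite /a; field; rewrite !gt_eqF.
Qed.

End EVaRTheory.

(** * Lagrange multiplier of a single constraint *)

Section LagrangeMultiplier.
Context (R : realType).

(** A concave program in one constraint, seen through the pairs (constraint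
    value [g], objective value [f]) that it attains: under a Slater point some
    line of slope [lam >= 0] through [(rho, v)] lies above all these pairs. The
    slope is the supremum of 0 and of the chord slopes from [(rho, v)] to the
    pairs with [g > rho]; convexity bounds them by the chord slopes to the pairs
    with [g < rho]. *)
Lemma lagrange_multiplier (A : R -> R -> Prop) (rho v : R) :
  (forall g f g' f' a, A g f -> A g' f' -> 0 < a < 1 ->
     A (a * g + (1 - a) * g') (a * f + (1 - a) * f')) ->
  (forall g f, A g f -> g <= rho -> f <= v) ->
  (exists g f, A g f /\ g < rho) ->
  exists2 lam, 0 <= lam & forall g f, A g f -> f <= v + lam * (g - rho).
Proof.
move=> Aconv Aopt [g0 [f0 [A0 g0rho]]].
pose L := [set l | l = 0 \/
  exists g f, [/\ A g f, rho < g & l = (f - v) / (g - rho)]].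
have L_ub g1 f1 : A g1 f1 -> g1 < rho -> ubound L ((v - f1) / (rho - g1)).
  move=> A1 g1rho l [->|[g [f [Agf rhog ->]]]].
    by rewrite divr_ge0// subr_ge0 ?(ltW g1rho)// (Aopt _ _ A1)// ltW.
  rewrite ler_pdivlMr ?subr_gt0// mulrAC ler_pdivrMr ?subr_gt0//.
  (* The chord from (g1, f1) to (g, f) meets the line g = rho at weight a. *)
  pose a := (rho - g1) / (g - g1).
  have d0 : 0 < g - g1 by rewrite subr_gt0 (lt_trans g1rho).
  have a01 : 0 < a < 1.
    apply/andP; split; first by rewrite divr_gt0// subr_gt0.
    by rewrite ltr_pdivrMr// mul1r ltrD2r.
  have := Aopt _ _ (Aconv _ _ _ _ _ Agf A1 a01).
  have -> : a * g + (1 - a) * g1 = rho by rewrite /a; field; rewrite gt_eqF.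
  move=> /(_ (lexx _)).
  have -> : a * f + (1 - a) * f1 =
      ((rho - g1) * f + (g - rho) * f1) / (g - g1).
    by rewrite /a; field; rewrite gt_eqF.
  rewrite ler_pdivrMr//; lra.
have L0 : L 0 by left.
have supL : has_sup L.
  by split; [exists 0 | exists ((v - f0) / (rho - g0)); exact: L_ub].
exists (sup L); first exact: sup_upper_bound.
move=> g f Agf; rewrite -lerBlDl; have [grho|rhog|grho] := ltgtP g rho.
- have : sup L <= (v - f) / (rho - g).
    by apply: ge_sup; [exists 0 | exact: L_ub].
  by rewrite ler_pdivlMr ?subr_gt0//; lra.
- rewrite -ler_pdivrMr ?subr_gt0//; apply: sup_upper_bound => //.
  by right; exists g, f.
- by rewrite grho subrr mulr0 subr_le0; apply: (Aopt _ _ Agf); rewrite grho.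
Qed.

End LagrangeMultiplier.

(** * The exponential cone *)

Section ExpConeTheory.
Context (R : realType).
Implicit Types a b c s : R.

(** The cone lies on one side of the tangent planes of its boundary. *)
Lemma exp_cone_tangent a b c s :
  exp_cone (a, b, c) -> expR s * (a + b * (1 - s)) <= c.
Proof.
move=> K; rewrite -subr_ge0.
pose F (v : R * R * R) := v.2 - expR s * (v.1.1 + v.1.2 * (1 - s)).
have cF : continuous F.
  move=> v; apply: cvgB; first exact: cvg_snd.
  apply: cvgM; first exact: cvg_cst.
  apply: cvgD.
    by apply: (@cvg_comp _ _ _ fst fst); [exact: cvg_fst | exact: cvg_fst].
  apply: cvgM; last exact: cvg_cst.
  by apply: (@cvg_comp _ _ _ fst snd); [exact: cvg_fst | exact: cvg_snd].
have : closed (F @^-1` [set x | 0 <= x]).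
  by apply: preimage_closed; [move=> x _; exact: cF | exact: closed_ge].
move=> /closure_id FE; suff : (F @^-1` [set x | 0 <= x]) (a, b, c) by [].
rewrite FE; apply: closure_subset K => -[[a' b'] c'] /= [b0 abc].
rewrite /F /= subr_ge0; apply: le_trans abc.
rewrite -[in leRHS](subrK s (a' / b')) expRD mulrA [leRHS]mulrC ler_wpM2l ?expR_ge0//.
have -> : a' + b' * (1 - s) = b' * (1 + (a' / b' - s)).
  by field; rewrite gt_eqF.
by rewrite ler_wpM2l ?(ltW b0) ?expR_ge1Dx.
Qed.

Lemma exp_cone_b_ge0 a b c : exp_cone (a, b, c) -> 0 <= b.
Proof.
move=> K; pose F (v : R * R * R) := v.1.2.
have cF : continuous F.
  move=> v.
  by apply: (@cvg_comp _ _ _ fst snd); [exact: cvg_fst | exact: cvg_snd].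
have : closed (F @^-1` [set x | 0 <= x]).
  by apply: preimage_closed; [move=> x _; exact: cF | exact: closed_ge].
move=> /closure_id FE; suff : (F @^-1` [set x | 0 <= x]) (a, b, c) by [].
by rewrite FE; apply: closure_subset K => -[[a' b'] c'] /= [/ltW].
Qed.

Lemma interior_exp_cone_b_gt0 a b c : interior exp_cone (a, b, c) -> 0 < b.
Proof.
move=> /nbhs_ex[d dK]; have d0 : 0 < d%:num by [].
have : exp_cone (a, b - d%:num / 2, c).
  apply: dK; split; [split|] => /=; rewrite -ball_normE /= ?subrr ?normr0//.
  by rewrite opprB addrC subrK gtr0_norm; lra.
by move=> /exp_cone_b_ge0; lra.
Qed.

Lemma exp_cone_le a b c : 0 < b -> exp_cone (a, b, c) -> b * expR (a / b) <= c.
Proof.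
move=> b0 /(exp_cone_tangent (a / b)); congr (_ <= _).
by field; rewrite gt_eqF.
Qed.

End ExpConeTheory.

(** * Conditions on the risk thresholds *)

Lemma sum_disjointU (R : realType) (N : finType) (F : N -> R) (S S' : {set N}) :
  S :&: S' = finset.set0 ->
  \sum_(i in S :|: S') F i = \sum_(i in S) F i + \sum_(i in S') F i.
Proof.
move=> SS'; rewrite -bigU/=; last by rewrite -finset.setI_eq0 SS'.
by apply: eq_bigl => i; rewrite !inE.
Qed.

Section RiskCore.
Context (R : realType) (N : finType) (risk : {set N} -> R).

(** Either condition on the thresholds gives the game [risk] a core
    allocation: the individual thresholds if [risk] is additive, equal shares
    if [risk S / #|S|] is monotone in [#|S|]. *)
Lemma risk_core : risk_additive risk \/ risk_ratio_monotone risk ->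
  [set: N]%SET != finset.set0 ->
  exists2 q : N -> R, \sum_i q i = risk [set: N]%SET &
    forall S : {set N}, S != finset.set0 -> risk S <= \sum_(i in S) q i.
Proof.
move=> [radd|rmon] N0.
  exists (fun i => risk [set i]%SET); last by move=> S _; rewrite -radd.
  by rewrite radd; apply: eq_bigl => i; rewrite finset.in_setT.
have nN0 : 0 < #|[set: N]%SET|%:R :> R by rewrite ltr0n card_gt0.
exists (fun=> risk [set: N]%SET / #|[set: N]%SET|%:R) => [|S S0].
  by rewrite sumr_const -cardsT -[LHS]mulr_natr divfK ?gt_eqF.
have nS0 : 0 < #|S|%:R :> R by rewrite ltr0n card_gt0.
rewrite sumr_const -[leRHS]mulr_natr -ler_pdivrMr//.
by apply: rmon => //; rewrite subset_leq_card ?finset.subsetT.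
Qed.

Lemma risk_superadditive : risk_additive risk \/ risk_ratio_monotone risk ->
  forall S S' : {set N}, S != finset.set0 -> S' != finset.set0 ->
  S :&: S' = finset.set0 -> risk S + risk S' <= risk (S :|: S').
Proof.
move=> riskP S S' S0 S'0 SS'.
case: riskP => [radd|rmon].
  by rewrite (radd S) (radd S') (radd (S :|: S')) sum_disjointU.
have nS0 : 0 < #|S|%:R :> R by rewrite ltr0n card_gt0.
have nS'0 : 0 < #|S'|%:R :> R by rewrite ltr0n card_gt0.
have U0 : S :|: S' != finset.set0 by rewrite finset.setU_eq0 negb_and S0.
have nE : #|S :|: S'|%:R = #|S|%:R + #|S'|%:R :> R.
  by rewrite cardsU SS' cards0 subn0 natrD.
have := rmon _ _ S0 U0 (subset_leq_card (finset.subsetUl S S')).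
have := rmon _ _ S'0 U0 (subset_leq_card (finset.subsetUr S S')).
rewrite !ler_pdivrMr// => h' h; apply: le_trans (lerD h h') _.
by rewrite -mulrDr -nE divfK ?nE// gt_eqF// addr_gt0.
Qed.

End RiskCore.

(** * The portfolio game *)

Section PortfolioGame.
Context (R : realType) (N : finType) (m T : nat).
Context (c : N -> R) (risk : {set N} -> R).
Context (p : 'I_T -> R) (r : 'I_m -> 'I_T -> R) (beta : R).
Context (nu : {set N} -> R).
Hypothesis p_ge0 : forall t, 0 <= p t.
Hypothesis p_sum1 : \sum_(t < T) p t = 1.
Hypothesis beta01 : 0 < beta < 1.
Hypothesis nuE : evar_game c risk p r beta nu.
Implicit Types (x : 'I_m -> R) (S : {set N}) (k : R).

Local Notation feasible := (evar_feasible c risk p r beta).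
Local Notation profit := (expected_return p r).

(** The EVaR of the portfolio [x], a sublinear function of [x]. *)
Definition portfolio_evar x : R := evar beta p (portfolio_return r x).

Lemma profitD x x' : profit (fun j => x j + x' j) = profit x + profit x'.
Proof.
by rewrite -big_split/=; apply: eq_bigr => j _; rewrite mulrDr.
Qed.

Lemma profitZ k x : profit (fun j => k * x j) = k * profit x.
Proof. by rewrite mulr_sumr; apply: eq_bigr => j _; rewrite mulrCA. Qed.

Lemma portfolio_evarZ_le k x : 0 < k ->
  portfolio_evar (fun j => k * x j) <= k * portfolio_evar x.
Proof.
move=> k0; rewrite /portfolio_evar.
have -> : portfolio_return r (fun j => k * x j) =
    (fun t => k * portfolio_return r x t).
  apply/funext => t; rewrite mulr_sumr.
  by apply: eq_bigr => j _; rewrite mulrCA.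
exact: evarZ_le.
Qed.

Lemma portfolio_evarD_le x x' :
  portfolio_evar (fun j => x j + x' j) <= portfolio_evar x + portfolio_evar x'.
Proof.
rewrite /portfolio_evar.
have -> : portfolio_return r (fun j => x j + x' j) =
    (fun t => portfolio_return r x t + portfolio_return r x' t).
  apply/funext => t; rewrite -big_split/=.
  by apply: eq_bigr => j _; rewrite mulrDr.
exact: evarD_le.
Qed.

Lemma nu_ge S x : feasible S x -> profit x <= nu S.
Proof.
move=> Sx; rewrite -lee_fin nuE; apply: ereal_sup_ubound.
by exists x.
Qed.

Lemma nu_le S b : (forall x, feasible S x -> profit x <= b) -> nu S <= b.
Proof.
move=> Sb; rewrite -lee_fin nuE; apply: ge_ereal_sup => _ [x Sx <-].
by rewrite lee_fin; exact: Sb.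
Qed.

(** Every coalition has a feasible portfolio, because its value is not [-oo]. *)
Lemma feasible_nonempty S : exists x, feasible S x.
Proof.
apply: contrapT => nx; have := nuE S.
have E0 : [set (profit x)%:E | x in feasible S] = set0.
  by apply/seteqP; split => // v [x Sx _]; apply: nx; exists x.
by rewrite E0 ereal_sup0.
Qed.

Lemma capital_ge0 S : 0 <= capital c S.
Proof. by have [x [<- _ x0]] := feasible_nonempty S; exact: sumr_ge0. Qed.

Lemma profit_eq0 x : (forall j, 0 <= x j) -> \sum_(j < m) x j = 0 ->
  profit x = 0.
Proof.
move=> x0 sx0; apply: big1 => j _.
have /eqP := sx0; rewrite psumr_eq0// => /allP/(_ j (mem_index_enum j))/eqP ->.
by rewrite mulr0.
Qed.

Lemma nu_eq0 S : capital c S = 0 -> nu S = 0.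
Proof.
move=> S0; apply/eqP; rewrite eq_le; apply/andP; split.
  by apply: nu_le => x [xS _ x0]; rewrite profit_eq0// xS.
have [x Sx] := feasible_nonempty S.
by rewrite -(profit_eq0 (x := x)); [exact: nu_ge | case: Sx | case: Sx => ->].
Qed.

Lemma nu_set0 : nu finset.set0 = 0.
Proof. by apply: nu_eq0; rewrite /capital big_set0. Qed.

Lemma nu_superadditive S S' : S :&: S' = finset.set0 ->
  risk S + risk S' <= risk (S :|: S') -> nu S + nu S' <= nu (S :|: S').
Proof.
move=> SS' rSS'; rewrite -lerBrDr; apply: nu_le => x [xS xr x0].
rewrite lerBrDr addrC -lerBrDr; apply: nu_le => x' [xS' xr' x0'].
rewrite lerBrDr -profitD; apply: nu_ge; split.
- by rewrite big_split/= xS xS' /capital addrC sum_disjointU.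
- apply: le_trans rSS'; apply: le_trans (portfolio_evarD_le _ _) _.
  by rewrite addrC lerD.
- by move=> j; rewrite addr_ge0.
Qed.

(** A Slater point of the cone program is strictly feasible for the EVaR
    constraint: with [z > 0], the inequalities on [u] bound the EVaR of the
    portfolio by [w + z ln (1 / (1 - beta))]. *)
Lemma slater_evar_lt S : cone_slater c risk p r beta S ->
  exists x, [/\ \sum_(j < m) x j = capital c S, portfolio_evar x < risk S &
                forall j, 0 <= x j].
Proof.
move=> [x [y [w [z [u [[xS yE _ x0 K] [_ wS uz Ki]]]]]]].
exists x; split => //.
have [t0 _] : exists t : 'I_T, True.
  apply: contrapT => nt; have := p_sum1; rewrite big1 => [/eqP|t _].
    by rewrite eq_sym oner_eq0.
  by case: nt; exists t.
have z0 : 0 < z := interior_exp_cone_b_gt0 (Ki t0).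
apply/evar_ltP => //; exists z => //; apply: le_lt_trans wS.
rewrite evar_expr_le//.
have b1 : 0 < 1 - beta by rewrite subr_gt0; case/andP: beta01.
have ew t : expR ((portfolio_return r x t - (w + z * ln (1 - beta)^-1)) / z) =
    (1 - beta) * expR ((y t - w) / z).
  rewrite -{2}[1 - beta]lnK ?posrE// -expRD yE lnV ?posrE//; congr expR.
  by field; rewrite gt_eqF.
under eq_bigr => t _ do rewrite ew mulrCA.
rewrite -mulr_sumr mulrA mulVf ?gt_eqF// mul1r -(ler_pM2l z0) mulr1.
apply: le_trans (ltW uz); rewrite mulr_sumr; apply: ler_sum => t _.
by rewrite mulrCA ler_wpM2l//; exact: exp_cone_le.
Qed.

(** The Lagrange multiplier of the risk constraint of the program of [S0] bounds
    the values of all coalitions, since the programs of two coalitions with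
    positive capital differ, up to scaling, by their threshold only. *)
Lemma nu_supergradient S0 : (forall S, 0 <= risk S) -> 0 < capital c S0 ->
  cone_slater c risk p r beta S0 ->
  exists2 lam, 0 <= lam & forall S,
    nu S <= capital c S / capital c S0 * (nu S0 - lam * risk S0) + lam * risk S.
Proof.
move=> risk_ge0 c0 /slater_evar_lt[x0 [x0S x0r x00]].
pose A g f := exists x, [/\ \sum_(j < m) x j = capital c S0,
  forall j, 0 <= x j, portfolio_evar x <= g & f = profit x].
have [g f g' f' a||| lam lam0 lamP] :=
    @lagrange_multiplier R A (risk S0) (nu S0).
- move=> [x [xS xp xg ->]] [x' [xS' xp' xg' ->]] /andP[a0 a1].
  have a1' : 0 < 1 - a by rewrite subr_gt0.
  exists (fun j => a * x j + (1 - a) * x' j); split.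
  + by rewrite big_split/= -!mulr_sumr xS xS' -mulrDl addrC subrK mul1r.
  + by move=> j; rewrite addr_ge0 ?mulr_ge0 ?(ltW a0) ?(ltW a1').
  + apply: le_trans (portfolio_evarD_le _ _) _.
    apply: lerD; apply: le_trans (portfolio_evarZ_le _ _) _ => //;
    by rewrite ler_pM2l.
  + by rewrite profitD !profitZ.
- move=> g f [x [xS xp xg ->]] gr; apply: nu_ge; split => //.
  exact: le_trans xg gr.
- by exists (portfolio_evar x0), (profit x0); split => //; exists x0.
exists lam => // S; apply: nu_le => x [xS xr xp].
have [cS0|cS0] := eqVneq (capital c S) 0.
  (* The only portfolio of S is 0, and scaling to the capital of S0 fails. *)
  by rewrite profit_eq0 ?xS// cS0 !mul0r add0r mulr_ge0.
have cS : 0 < capital c S by rewrite lt_def cS0 capital_ge0.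
pose k := capital c S0 / capital c S.
have k0 : 0 < k by rewrite divr_gt0.
have /lamP : A (k * risk S) (k * profit x).
  exists (fun j => k * x j); split.
  + by rewrite -mulr_sumr xS divfK.
  + by move=> j; rewrite mulr_ge0 ?(ltW k0).
  + apply: le_trans (portfolio_evarZ_le _ k0) _.
    by rewrite ler_pM2l.
  + by rewrite profitZ.
rewrite -(ler_pM2l k0 (profit x)) => /le_trans; apply.
rewrite le_eqVlt; apply/orP; left; apply/eqP; rewrite /k.
by field; rewrite cS0 gt_eqF.
Qed.

End PortfolioGame.

(** * Superadditivity and core *)

Theorem theorem16 (R : realType) (N : finType) (m T : nat)
    (c : N -> R) (risk : {set N} -> R)
    (p : 'I_T -> R) (r : 'I_m -> 'I_T -> R) (beta : R)
    (nu : {set N} -> R)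
    (risk_ge0 : forall S : {set N}, 0 <= risk S)
    (p_ge0 : forall t, 0 <= p t)
    (p_sum1 : \sum_(t < T) p t = 1)
    (beta01 : 0 < beta < 1)
    (nuE : evar_game c risk p r beta nu)
    (riskP : risk_additive risk \/ risk_ratio_monotone risk) :
  superadditive nu /\
  (cone_slater c risk p r beta [set: N]%SET -> core nu !=set0).
Proof.
split=> [S S' SS'|slater].
  have [->|S0] := eqVneq S finset.set0.
    by rewrite (nu_set0 nuE) add0r finset.set0U.
  have [->|S'0] := eqVneq S' finset.set0.
    by rewrite (nu_set0 nuE) addr0 finset.setU0.
  apply: (nu_superadditive p_ge0 p_sum1 beta01 nuE SS').
  exact: risk_superadditive.
have c_ge0 i : 0 <= c i.
  by have := capital_ge0 nuE [set i]%SET; rewrite /capital big_set1.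
have capT : capital c [set: N]%SET = \sum_i c i.
  by apply: eq_bigl => i; rewrite finset.in_setT.
have [cN0|cN0] := eqVneq (capital c [set: N]%SET) 0.
  (* Without capital, every coalition has value 0. *)
  have nu0 S : nu S = 0.
    apply: (nu_eq0 nuE); apply: big1 => i _.
    move: cN0; rewrite capT => /eqP; rewrite psumr_eq0//.
    by move=> /allP/(_ i (mem_index_enum i))/eqP.
  by exists (fun=> 0); split => [|S _ _]; rewrite nu0 big1.
have cN : 0 < capital c [set: N]%SET by rewrite lt_def cN0 (capital_ge0 nuE).
have [lam lam0 lamP] :=
  nu_supergradient p_ge0 p_sum1 beta01 nuE risk_ge0 cN slater.
have N0 : [set: N]%SET != finset.set0.
  by apply: contra_neq cN0 => ->; rewrite /capital big_set0.
have [q qN qS] := risk_core riskP N0.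
set kappa := nu [set: N]%SET - lam * risk [set: N]%SET in lamP.
exists (fun i => c i / capital c [set: N]%SET * kappa + lam * q i); split.
  rewrite big_split/= -mulr_suml -mulr_suml -mulr_sumr -capT qN divff// mul1r.
  by rewrite subrK.
move=> S S0 _; apply: le_trans (lamP S) _.
rewrite big_split/= -mulr_suml -mulr_suml -mulr_sumr lerD2l.
by rewrite ler_wpM2l ?qS.
Qed.
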